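(* Assume the setting and Assumptions (A1), (A2), (A3) in the context, and let $\eta>0$, $\zeta>\tfrac12$, $\rho\in(0,1)$ with $\alpha_0\le\frac{\rho(2\zeta-1)}{\zeta L_{\nabla f}\tilde B}$. Then there exist constants $C_1,C_2>0$ (independent of $K$) such that for all $K\ge1$ $$\min_{0\le k\le K-1}\mathbb{E}\|\nabla f(\theta^k)\|^2\le\frac{C_1}{K\alpha_K}+C_2L_K,\qquad L_K\coloneqq\frac{1}{K\alpha_K}\sum_{k=0}^{K-1}\alpha_k\epsilon_k^2 .$$ Moreover, if $\lim_{K\to\infty}L_K=0$, then $\lim_{K\to\infty}\min_{0\le k\le K-1}\mathbb{E}\|\nabla f(\theta^k)\|=0$.
   Context: Setting: $\theta\in\mathbb{R}^d$; $f_1,\dots,f_m:\mathbb{R}^d\to\mathbb{R}$, $f=\frac1m\sum_i f_i$. $\mathcal D$ is a distribution on $v\in\mathbb{R}^m$ with independent entries, $\mathbb{E}[v_i]=1$, $\mathbb{E}[v_i^2]<\infty$; $f_v=\frac1m\sum_iv_if_i$. Inexact stochastic gradient $z_v(\theta)=\nabla f_v(\theta)+e_v(\theta)$. Algorithm ISGD: deterministic $\theta^0$; for $k=0,1,\dots$ sample $v^k\sim\mathcal D$ independently of the past, $\theta^{k+1}=\theta^k-\alpha_kz_{v^k}(\theta^k)$, with positive step sizes $\alpha_k$ and non-negative accuracies $\epsilon_k$. (A1): each $f_i$ is $C^1$ with Lipschitz gradient and bounded below; $f$ has $L_{\nabla f}$-Lipschitz gradient and is bounded below by $f^{\inf}$;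 $A,B,C\ge0$ satisfy $\mathbb{E}_v\|\nabla f_v(\theta)\|^2\le2A(f(\theta)-f^{\inf})+B\|\nabla f(\theta)\|^2+C$ for all $\theta$. (A2): $\mathbb{E}[\|e_{v^k}(\theta^k)\|^2\mid\theta^k]\le\epsilon_k^2$ for all $k$, $\{\epsilon_k\}$ deterministic. (A3): $\{\alpha_k\}$ is positive and non-increasing, $\sum_{k}\alpha_k^2<\infty$, and $\lim_{k\to\infty}\frac{1}{k\alpha_k}=0$. Notation: $\tilde B=\frac{1+\eta}{\eta}B$. *)

(* Defs.v *)
From HB Require Import structures.
From mathcomp Require Import all_boot all_order all_algebra.
From mathcomp Require Import all_classical all_reals all_analysis.
Set Implicit Arguments. Unset Strict Implicit. Unset Printing Implicit Defensive.
Import Order.TTheory GRing.Theory Num.Theory.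
Import numFieldNormedType.Exports.
Local Open Scope classical_set_scope.
Local Open Scope ring_scope.

Section Defs.
Variable R : realType.

Definition dotp n (x y : 'rV[R]_n) : R := \sum_(j < n) x 0 j * y 0 j.
Definition sqnorm n (x : 'rV[R]_n) : R := \sum_(j < n) x 0 j ^+ 2.
Definition enorm n (x : 'rV[R]_n) : R := Num.sqrt (sqnorm x).

Definition is_gradient n (F : 'rV[R]_n -> R) (G : 'rV[R]_n -> 'rV[R]_n) :=
  forall x, differentiable F x /\ ('d F x : 'rV[R]_n -> R) = dotp (G x).

Definition euclid_lipschitz n (G : 'rV[R]_n -> 'rV[R]_n) (L : R) :=
  forall x y, enorm (G x - G y) <= L * enorm (x - y).

(** f = (1/m) sum_i f_i, its gradient, and the gradient of f_v *)
Definition favg m n (f : 'I_m -> 'rV[R]_n -> R) (x : 'rV[R]_n) : R :=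
  m%:R^-1 * \sum_(i < m) f i x.
Definition gavg m n (g : 'I_m -> 'rV[R]_n -> 'rV[R]_n) (x : 'rV[R]_n) :=
  m%:R^-1 *: \sum_(i < m) g i x.
Definition gradv m n (g : 'I_m -> 'rV[R]_n -> 'rV[R]_n) (v : 'rV[R]_m)
  (x : 'rV[R]_n) := m%:R^-1 *: \sum_(i < m) v 0 i *: g i x.

Definition borel_set (T : topologicalType) (A : set T) := <<s @open T >> A.
Definition borel_map (T U : topologicalType) (F : T -> U) :=
  forall B : set U, open B -> borel_set (F @^-1` B).

Section Prob.
Context d (Omega : measurableType d) (P : probability Omega R).

Definition mutually_independent (I : eqType) (X : I -> {RV P >-> R}) :=
  forall (J : seq I) (B : I -> set R), uniq J ->
    (forall j, j \in J -> measurable (B j)) ->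
    P [set w | forall j, j \in J -> B j (X j w)]
    = (\prod_(j <- J) P (X j @^-1` B j))%E.

Definition same_law (X Y : {RV P >-> R}) :=
  forall B : set R, measurable B -> P (X @^-1` B) = P (Y @^-1` B).

Definition vrow m (v : nat -> 'I_m -> {RV P >-> R}) k (w : Omega) : 'rV[R]_m :=
  \row_i v k i w.

Fixpoint isgd m n (g : 'I_m -> 'rV[R]_n -> 'rV[R]_n)
  (e : nat -> 'rV[R]_m -> 'rV[R]_n -> 'rV[R]_n)
  (v : nat -> 'I_m -> {RV P >-> R}) (alpha : nat -> R) (theta0 : 'rV[R]_n)
  (k : nat) (w : Omega) : 'rV[R]_n :=
  match k with
  | 0 => theta0
  | k'.+1 =>
    let th := isgd g e v alpha theta0 k' w in
    th - alpha k' *: (gradv g (vrow v k' w) th + e k' (vrow v k' w) th)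
  end.
End Prob.

Definition LK (alpha eps : nat -> R) (K : nat) : R :=
  (K%:R * alpha K)^-1 * \sum_(k < K) alpha k * eps k ^+ 2.
End Defs.

(* Main.v *)
Require Import Defs.
From HB Require Import structures.
From mathcomp Require Import all_boot all_order all_algebra.
From mathcomp Require Import all_classical all_reals all_analysis.
From mathcomp Require Import measurable_realfun ring lra.
Set Implicit Arguments. Unset Strict Implicit. Unset Printing Implicit Defensive.
Import Order.TTheory GRing.Theory Num.Theory.
Import numFieldNormedType.Exports.
Local Open Scope classical_set_scope.
Local Open Scope ring_scope.

(** The descent lemma bounds [f(theta^(k+1))] by a quadratic model at [theta^k].
    Young's inequality with parameter [zeta] absorbs the cross term between the
    gradient and the error, and Young's inequality with parameter [eta] splits
    [|grad f_v + e|^2].  Since [v^k] is independent of the past, [grad f_v] has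
    conditional mean [grad f] and its conditional second moment obeys the ABC
    bound; both facts only involve first and second moments of the entries of
    [v^k], because [grad f_v] is linear in [v].  The step size condition leaves
      r_(k+1) <= (1 + a alpha_k^2) r_k - c alpha_k E|grad f(theta^k)|^2
                 + q alpha_k^2 + D alpha_k eps_k^2
    for [r_k = E f(theta^k) - f_inf] with [c > 0].  As [sum alpha_k^2] is finite,
    Gronwall bounds [sum_(k<K) alpha_k E|grad f(theta^k)|^2], and monotonicity of
    [alpha] turns this weighted sum into a bound on the minimum. *)

(** * Independence *)

Section IndependentProduct.
Context (R : realType) (d : measure_display) (Omega : measurableType d)
  (P : probability Omega R).

Definition independent_pair (X Y : Omega -> R) :=
  forall A B : set R, measurable A -> measurable B ->
    P ((X @^-1` A) `&` (Y @^-1` B)) = (P (X @^-1` A) * P (Y @^-1` B))%E.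

Lemma independent_pair_comp (X Y : Omega -> R) (h : R -> R) :
  measurable_fun setT h -> independent_pair X Y -> independent_pair (h \o X) Y.
Proof.
move=> mh XY A B mA mB; rewrite comp_preimage XY//.
by rewrite -[_ @^-1` _]setTI; exact: mh.
Qed.

(** Independence identifies the law of the pair with the product of the two laws. Tonelli applied to
    [|x * y|] gives integrability, and Fubini then factors the integral. *)
Lemma independent_pair_integral (X Y : {mfun Omega >-> R}) :
  independent_pair X Y ->
  P.-integrable setT (EFin \o X) -> P.-integrable setT (EFin \o Y) ->
  P.-integrable setT (EFin \o (fun w => X w * Y w)) /\
  (\int[P]_w (X w * Y w)%:E = \int[P]_w (X w)%:E * \int[P]_w (Y w)%:E)%E.
Proof.
move=> XY iX iY.
pose m1 := distribution P X; pose m2 := distribution P Y.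
pose XYp := fun w => (X w, Y w).
have mXY : measurable_fun setT XYp by exact: measurable_fun_pair.
pose XYm : {mfun Omega >-> (R * R)%type} := HB.pack XYp (isMeasurableFun.Build _ _ _ _ XYp mXY).
pose m3 := distribution P XYm.
(* A product measure is determined by its values on rectangles, which is exactly what independence
   provides. *)
have m3E A : measurable A -> (m1 \x m2)%E A = m3 A.
  apply: product_measure_unique => A' B' mA mB; rewrite -XY//.
pose F (z : R * R) : \bar R := (z.1 * z.2)%:E.
have mF : measurable_fun [set: (R * R)%type] F.
  apply/measurable_EFinP; apply: measurable_funM; first exact: measurable_fst.
  exact: measurable_snd.
have eq_m (h : R * R -> \bar R) : (\int[m3]_z h z = \int[(m1 \x m2)%E]_z h z)%E.
  by apply: eq_measure_integral => A mA _; (exact: m3E || exact/esym/m3E).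
have absX : (\int[m1]_x `|x%:E| < +oo)%E.
  rewrite ge0_integral_distribution//; last first.
    exact: measurableT_comp.
  by move/integrableP: iX => [_].
have absY : (\int[m2]_x `|x%:E| < +oo)%E.
  rewrite ge0_integral_distribution//; last first.
    exact: measurableT_comp.
  by move/integrableP: iY => [_].
have FtonE : (\int[(m1 \x m2)]_z `|F z| = \int[m1]_x `|x%:E| * \int[m2]_y `|y%:E|)%E.
  rewrite fubini_tonelli1//; last exact: measurableT_comp.
  rewrite /fubini_F /F /=.
  under eq_integral => x _.
    under eq_integral do rewrite normrM EFinM.
    rewrite ge0_integralZl//; last exact: measurableT_comp.
    over.
  rewrite ge0_integralZr//; last 2 first.
    exact: measurableT_comp.
    exact: integral_ge0.
have iF : (m1 \x m2)%E.-integrable setT F.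
  apply/integrableP; split => //; rewrite FtonE.
  by rewrite lte_mul_pinfty ?integral_ge0// ge0_fin_numE// integral_ge0.
have iXY : P.-integrable setT (EFin \o (fun w => X w * Y w)).
  apply/integrableP; split.
    by apply/measurable_EFinP; exact: measurable_funM.
  move/integrableP : iF => [_]; rewrite -eq_m ge0_integral_distribution//.
  exact: measurableT_comp.
split=> //.
rewrite -[LHS](@integral_distribution _ _ _ _ _ P XYm F)//.
rewrite eq_m -integral12_prod_meas1//.
rewrite /fubini_F /F /=.
have iY2 : m2.-integrable setT EFin.
  by apply/integrableP; split => //.
have iX1 : m1.-integrable setT EFin.
  by apply/integrableP; split => //.
under eq_integral => x _.
  under eq_integral do rewrite EFinM.
  rewrite integralZl//.
  over.
rewrite -[(\int[m2]_x x%:E)%E]fineK; last exact: integrable_fin_num.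
rewrite integralZr//= fineK; last exact: integrable_fin_num.
by rewrite !integral_distribution.
Qed.

End IndependentProduct.

(** * Independence of one coordinate from the sigma-algebra generated by others *)

Section Cylinders.
Context (R : realType) (d : measure_display) (Omega : measurableType d)
  (P : probability Omega R) (I : eqType) (X : I -> {RV P >-> R}).

(** A pi-system generating the sigma-algebra of the family of [X j] with [j] in [S]. The sets [B j]
    are measurable for every [j], also outside [J], so that two families can be merged freely. *)
Definition cylinders (S : set I) : set (set Omega) :=
  [set E | exists (J : seq I) (B : I -> set R),
    [/\ uniq J, (forall j, j \in J -> S j), (forall j, measurable (B j)) &
        E = [set w | forall j, j \in J -> B j (X j w)]]].

Lemma cylinders_measurable (S : set I) : cylinders S `<=` measurable.
Proof.
move=> _ [J [B [_ _ mB ->]]].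
elim: J => [|i J IH].
  by rewrite (_ : [set _ | _] = setT)//; apply/seteqP; split.
rewrite (_ : [set _ | _] = (X i @^-1` B i) `&`
    [set w | forall j, j \in J -> B j (X j w)]).
  apply: measurableI IH; rewrite -[_ @^-1` _]setTI; exact: measurable_funP.
apply/seteqP; split => w /=.
  move=> h; split; first by apply: h; rewrite inE eqxx.
  by move=> j jJ; apply: h; rewrite inE jJ orbT.
by move=> [h1 h2] j; rewrite inE => /orP[/eqP -> //|]; exact: h2.
Qed.

Lemma cylinders_setI_closed (S : set I) : setI_closed (cylinders S).
Proof.
move=> _ _ [J1 [B1 [u1 S1 m1 ->]]] [J2 [B2 [u2 S2 m2 ->]]].
(* Each family is padded with [setT] outside its own index list, so that one family serves the union
   of the two lists. *)
pose B j := (if j \in J1 then B1 j else setT) `&`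
            (if j \in J2 then B2 j else setT).
exists (undup (J1 ++ J2)), B; split.
- exact: undup_uniq.
- by move=> j; rewrite mem_undup mem_cat => /orP[/S1|/S2].
- by move=> j; apply: measurableI; case: ifPn.
- apply/seteqP; split => w /=.
    by move=> [h1 h2] j _; split; case: ifPn => // jJ; [exact: h1|exact: h2].
  move=> h; split => j jJ.
    have [] := h j; first by rewrite mem_undup mem_cat jJ.
    by rewrite jJ.
  have [] := h j; first by rewrite mem_undup mem_cat jJ orbT.
  by rewrite jJ.
Qed.

Lemma sigma_cylinders_measurable (S : set I) :
  <<s cylinders S >> `<=` measurable.
Proof.
apply: smallest_sub; last exact: cylinders_measurable.
exact: sigma_algebra_measurable.
Qed.

Notation cylinderType S := (g_sigma_algebraType (cylinders S)).

Lemma cylinder_measurable_fun d' (U : measurableType d') (S : set I)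
    (Y : Omega -> U) :
  measurable_fun (setT : set (cylinderType S)) (Y : cylinderType S -> U) ->
  measurable_fun setT Y.
Proof.
move=> mY _ B mB; apply: sigma_cylinders_measurable.
exact: (mY measurableT B mB).
Qed.

Lemma cylinders_subset (S S' : set I) : S `<=` S' -> cylinders S `<=` cylinders S'.
Proof.
by move=> SS' _ [J [B [u h m ->]]]; exists J, B; split => // j /h /SS'.
Qed.

Lemma cylinder_measurable_funS d' (U : measurableType d') (S S' : set I)
    (Y : Omega -> U) : S `<=` S' ->
  measurable_fun (setT : set (cylinderType S)) (Y : cylinderType S -> U) ->
  measurable_fun (setT : set (cylinderType S')) (Y : cylinderType S' -> U).
Proof.
move=> SS' mY _ B mB; apply: (sub_smallest2r _ (cylinders_subset SS')).
  exact: smallest_sigma_algebra.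
exact: (mY measurableT B mB).
Qed.

Lemma cylinder_measurable_coord (S : set I) (j : I) : S j ->
  measurable_fun (setT : set (cylinderType S)) (X j : cylinderType S -> R).
Proof.
move=> Sj _ B mB; apply: sub_sigma_algebra.
exists [:: j], (fun=> B); split => //.
  by move=> k; rewrite inE => /eqP ->.
rewrite setTI; apply/seteqP; split => w /=.
  by move=> h k; rewrite inE => /eqP ->.
by apply; rewrite inE.
Qed.

Hypothesis indX : mutually_independent X.

Lemma cylinder_independent (S : set I) (p : I) (A : set R) :
  ~ S p -> measurable A -> forall E, <<s cylinders S >> E ->
  P ((X p @^-1` A) `&` E) = (P (X p @^-1` A) * P E)%E.
Proof.
move=> Sp mA.
have mXA : measurable (X p @^-1` A).
  by rewrite -[_ @^-1` _]setTI; exact: measurable_funP.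
have fA : (P (X p @^-1` A) < +oo)%E by rewrite -ge0_fin_numE// fin_num_measure.
have mle E : <<s cylinders S >> E -> measurable E.
  exact: sigma_cylinders_measurable.
pose Q E := P ((X p @^-1` A) `&` E) = (P (X p @^-1` A) * P E)%E.
have QC (E : set Omega) : measurable E -> Q E -> Q (~` E).
  move=> mE; rewrite /Q => QE; rewrite probability_setC// -setDE.
  have -> : P (X p @^-1` A `\` E) =
      (P (X p @^-1` A) - P (X p @^-1` A `&` E))%E by rewrite measureD.
  by rewrite QE muleBr ?mule1// ?fin_num_adde_defr ?fin_num_measure.
have QU (F : (set Omega)^nat) : (forall k, measurable (F k)) ->
    trivIset setT F -> (forall k, Q (F k)) -> Q (\bigcup_k F k).
  move=> mF tF QF; rewrite /Q setI_bigcupr measure_bigcup//=; last 2 first.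
    by move=> k _; exact: measurableI.
    exact: trivIset_setIl.
  have [c cE] : exists c, P (X p @^-1` A) = c%:E.
    by exists (fine (P (X p @^-1` A))); rewrite fineK// fin_num_measure.
  rewrite measure_bigcup//= cE -nneseriesZl//.
  by apply: eq_eseriesr => k _; rewrite -cE; exact: QF.
apply: (@dynkin_induction _ (cylinderType S) (cylinders S) Q) => //.
- exact: cylinders_setI_closed.
- by rewrite /Q setIT probability_setT mule1.
- move=> E [J [B [uJ SJ mB ->]]]; rewrite /Q.
  have pJ : p \notin J by apply/negP => /SJ.
  (* Intersecting with the event on [X p] gives a cylinder over [p :: J], to which mutual
     independence applies directly. *)
  pose B' j := if j == p then A else B j.
  have B'J j : j \in J -> B' j = B j.
    by rewrite /B'; case: eqP => // ->; rewrite (negbTE pJ).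
  have -> : X p @^-1` A `&` [set w | forall j, j \in J -> B j (X j w)] =
     [set w | forall j, j \in p :: J -> B' j (X j w)].
    apply/seteqP; split => w /=.
      move=> [h1 h2] j; rewrite inE /B' => /orP[/eqP ->|jJ]; first by rewrite eqxx.
      by case: eqP => [->//|_]; exact: h2.
    move=> h; split; first by have := h p; rewrite inE eqxx /B' eqxx => /(_ isT).
    by move=> j jJ; rewrite -B'J//; apply: h; rewrite inE jJ orbT.
  rewrite indX/=; last 2 first.
    by rewrite pJ.
    by move=> j _; rewrite /B'; case: ifP.
  rewrite big_cons {1}/B' eqxx indX//.
  by congr (_ * _)%E; apply: eq_big_seq => j jJ; rewrite B'J.
- by move=> E mE; exact: QC (mle _ mE).
- by move=> F mF; exact: QU (fun k => mle _ (mF k)).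
Qed.

Lemma cylinder_independent_pair (S : set I) (p : I) (Y : Omega -> R) :
  ~ S p ->
  measurable_fun (setT : set (cylinderType S)) (Y : cylinderType S -> R) ->
  independent_pair P (X p) Y.
Proof.
move=> Sp mY A B mA mB.
have YB : <<s cylinders S >> (Y @^-1` B).
  by have := mY measurableT B mB; rewrite setTI.
exact: (cylinder_independent Sp mA YB).
Qed.

(** The function [h] is a parameter so that the identity gives first moments and the square gives
    second moments. *)
Lemma cylinder_integral (S : set I) (p : I) (h : R -> R) (Y : Omega -> R) :
  ~ S p -> measurable_fun setT h ->
  measurable_fun (setT : set (cylinderType S)) (Y : cylinderType S -> R) ->
  P.-integrable setT (EFin \o (h \o X p)) -> P.-integrable setT (EFin \o Y) ->
  P.-integrable setT (EFin \o (fun w => h (X p w) * Y w)) /\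
  (\int[P]_w (h (X p w) * Y w) = (\int[P]_w h (X p w)) * \int[P]_w Y w)%R.
Proof.
move=> Sp mh mY ihX iY.
have mY' := cylinder_measurable_fun mY.
have mhX : measurable_fun setT (h \o X p) by exact: measurableT_comp.
pose hX : {mfun Omega >-> R} := HB.pack (h \o X p) (isMeasurableFun.Build _ _ _ _ (h \o X p) mhX).
pose Yf : {mfun Omega >-> R} := HB.pack Y (isMeasurableFun.Build _ _ _ _ Y mY').
have ind : independent_pair P hX Yf.
  by apply: independent_pair_comp => //; exact: cylinder_independent_pair mY.
have [i1 i2] := independent_pair_integral ind ihX iY.
split=> //; rewrite /Rintegral [X in fine X]i2 fineM//; exact: integrable_fin_num.
Qed.

End Cylinders.

(** * Borel measurability of vector-valued maps *)

Section BorelVector.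
Context (R : realType) (d : measure_display) (T : measurableType d).

(** Stated through preimages of open sets to match [borel_map], so that the two compose without
    fixing a measurable structure on [V]. *)
Definition borel_measurable (V : topologicalType) (F : T -> V) :=
  forall U : set V, open U -> measurable (F @^-1` U).

(** The sets with measurable preimage form a sigma-algebra that contains the open sets. *)
Lemma borel_measurable_preimage (V : topologicalType) (F : T -> V) (A : set V) :
  borel_measurable F -> borel_set A -> measurable (F @^-1` A).
Proof.
move=> mF; move: A; apply: smallest_sub => [|U oU]; last exact: mF.
split => /=; first by rewrite preimage_set0.
  by move=> A mA; rewrite setTD preimage_setC; exact: measurableC.
by move=> A mA; rewrite preimage_bigcup; exact: bigcupT_measurable.
Qed.

Lemma borel_map_measurable (V W : topologicalType) (h : V -> W) (F : T -> V) :
  borel_map h -> borel_measurable F -> borel_measurable (h \o F).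
Proof.
by move=> bh mF U oU; rewrite comp_preimage; exact: borel_measurable_preimage (bh _ oU).
Qed.

Lemma continuous_borel_map (V W : topologicalType) (h : V -> W) :
  continuous h -> borel_map h.
Proof.
by move=> ch U oU; apply: sub_sigma_algebra; apply: open_comp => // x _; exact: ch.
Qed.

Lemma borel_measurable_real (F : T -> R) :
  borel_measurable F -> measurable_fun setT F.
Proof.
move=> mF; apply: (measurability _ (RGenOpens.measurableE R)).
by move=> _ [_ [x [y ->]] <-]; rewrite setTI; apply: mF; exact: interval_open.
Qed.

Lemma borel_measurable_coord n (F : T -> 'rV[R]_n) (j : 'I_n) :
  borel_measurable F -> measurable_fun setT (fun t => F t 0 j).
Proof.
move=> mF; apply: borel_measurable_real.
apply: (borel_map_measurable (h := fun x : 'rV[R]_n => x 0 j)) mF.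
by apply: continuous_borel_map; exact: coord_continuous.
Qed.

(* An open set is a countable union of boxes with rational centres and radii
   1 / (k + 1). *)
Lemma coord_borel_measurable_pair a b (F : T -> 'rV[R]_a) (G : T -> 'rV[R]_b) :
  (forall i, measurable_fun setT (fun t => F t 0 i)) ->
  (forall i, measurable_fun setT (fun t => G t 0 i)) ->
  borel_measurable (fun t => (F t, G t)).
Proof.
move=> mF mG U oU.
pose box (z : 'rV[rat]_a * 'rV[rat]_b * nat) : set ('rV[R]_a * 'rV[R]_b) :=
  [set p : 'rV[R]_a * 'rV[R]_b | (forall i, `|p.1 0 i - ratr (z.1.1 0 i)| < z.2.+1%:R^-1) /\
           (forall i, `|p.2 0 i - ratr (z.1.2 0 i)| < z.2.+1%:R^-1)].
have mball (h : T -> R) (q r : R) : measurable_fun setT h ->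
    measurable [set t | `|h t - q| < r].
  move=> mh; rewrite (_ : [set t | _] = h @^-1` (ball q r)).
    rewrite -[_ @^-1` _]setTI; apply: mh => //.
    by apply: open_measurable; exact: ball_open.
  by apply/seteqP; split => t; rewrite /ball /= distrC.
have mbox z : measurable ((fun t => (F t, G t)) @^-1` box z).
  rewrite (_ : _ @^-1` _ =
    (\bigcap_i [set t | `|F t 0 i - ratr (z.1.1 0 i)| < z.2.+1%:R^-1]) `&`
    (\bigcap_i [set t | `|G t 0 i - ratr (z.1.2 0 i)| < z.2.+1%:R^-1])).
    by apply: measurableI; apply: fin_bigcap_measurable => // i _; exact: mball.
  apply/seteqP; split => t /= [h1 h2].
    by split => i _; [exact: h1|exact: h2].
  by split => i; [exact: h1|exact: h2].
(* The union runs over the countable type of all boxes; those not contained in [U] contribute the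
   empty set. *)
rewrite (_ : _ @^-1` U = \bigcup_z (if pselect (box z `<=` U)
    then (fun t => (F t, G t)) @^-1` box z else set0)).
  apply: countable_bigcupT_measurable; first exact: countableP.
  by move=> z; case: pselect => zU /=; [exact (mbox z)|exact: measurable0].
apply/seteqP; split => t /=; last first.
  by move=> [z _]; case: pselect => // zU /zU.
move=> Ut.
have /nbhs_ballP[e /= e0 eU] : nbhs (F t, G t) U by exact: open_nbhs_nbhs.
(* The factor 2 pays for the triangle inequality through the rational centre: two points of one box
   differ by less than twice the radius in each coordinate. *)
have [k ke] : exists k : nat, 2 * k.+1%:R^-1 < e.
  have [k _ /(_ k (leqnn _))] := near_infty_natSinv_lt (PosNum (divr_gt0 e0 (ltr0n _ 2))).
  by move=> /= h; exists k; rewrite mulrC -ltr_pdivlMr.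
have k0 : (0 : R) < k.+1%:R^-1 by rewrite invr_gt0.
have [r rE] : exists r : R, r = k.+1%:R^-1 by eexists.
have app (x : R) : exists q : rat, `|x - ratr q| < k.+1%:R^-1.
  rewrite -rE in k0 *.
  have [|q] := @rat_in_itvoo R (x - r) (x + r); first by lra.
  rewrite in_itv /= => /andP[h1 h2]; exists q; rewrite ltr_norml; lra.
have [qa qaP] := choice app.
pose z := (\row_i qa (F t 0 i), \row_i qa (G t 0 i), k).
exists z => //; case: pselect => [zU|]; first by split => i /=; rewrite mxE.
apply => -[x y] [/= hx hy]; apply: eU; split; split => // i j.
- rewrite ord1; have := hx j; have := qaP (F t 0 j).
  rewrite mxE /ball /= -rE => h1 h2; rewrite -rE in ke.
  rewrite (_ : _ - _ = (F t 0 j - ratr (qa (F t 0 j))) - (x 0 j - ratr (qa (F t 0 j)))); last by ring.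
  by apply: le_lt_trans (ler_normB _ _) _; lra.
- rewrite ord1; have := hy j; have := qaP (G t 0 j).
  rewrite mxE /ball /= -rE => h1 h2; rewrite -rE in ke.
  rewrite (_ : _ - _ = (G t 0 j - ratr (qa (G t 0 j))) - (y 0 j - ratr (qa (G t 0 j)))); last by ring.
  by apply: le_lt_trans (ler_normB _ _) _; lra.
Qed.

Lemma coord_borel_measurable n (F : T -> 'rV[R]_n) :
  (forall i, measurable_fun setT (fun t => F t 0 i)) -> borel_measurable F.
Proof.
move=> mF U oU.
rewrite (_ : F @^-1` U = (fun t => (F t, F t)) @^-1` (fst @^-1` U))//.
apply: coord_borel_measurable_pair => //.
by apply: open_comp => // p _; exact: cvg_fst.
Qed.

Lemma continuous_coord_measurable n (h : 'rV[R]_n -> R) (F : T -> 'rV[R]_n) :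
  continuous h -> (forall i, measurable_fun setT (fun t => F t 0 i)) ->
  measurable_fun setT (fun t => h (F t)).
Proof.
move=> ch mF; apply: borel_measurable_real.
apply: (borel_map_measurable (h := h)); first exact: continuous_borel_map.
exact: coord_borel_measurable.
Qed.

End BorelVector.

(** * Euclidean geometry and the descent lemma *)

Section Euclidean.
Context (R : realType) (n : nat).
Implicit Types (x y z : 'rV[R]_n) (c : R).

Lemma dotpC x y : dotp x y = dotp y x.
Proof. by apply: eq_bigr => j _; rewrite mulrC. Qed.

Lemma dotpDl x y z : dotp (x + y) z = dotp x z + dotp y z.
Proof. by rewrite /dotp -big_split; apply: eq_bigr => j _; rewrite mxE mulrDl. Qed.

Lemma dotpZl c x y : dotp (c *: x) y = c * dotp x y.
Proof. by rewrite /dotp mulr_sumr; apply: eq_bigr => j _; rewrite mxE mulrA. Qed.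

Lemma dotp0l x : dotp 0 x = 0.
Proof. by rewrite -(scale0r 0) dotpZl mul0r. Qed.

Lemma dotpDr x y z : dotp x (y + z) = dotp x y + dotp x z.
Proof. by rewrite dotpC dotpDl !(dotpC x). Qed.

Lemma dotpZr c x y : dotp x (c *: y) = c * dotp x y.
Proof. by rewrite dotpC dotpZl dotpC. Qed.

Lemma sqnormE x : sqnorm x = dotp x x.
Proof. by apply: eq_bigr => j _; rewrite expr2. Qed.

Lemma sqnorm_ge0 x : 0 <= sqnorm x.
Proof. by apply: sumr_ge0 => j _; exact: sqr_ge0. Qed.

Lemma sqnormZ c x : sqnorm (c *: x) = c ^+ 2 * sqnorm x.
Proof. by rewrite !sqnormE dotpZl dotpZr mulrA expr2. Qed.

Lemma sqnormD x y : sqnorm (x + y) = sqnorm x + 2 * dotp x y + sqnorm y.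
Proof. by rewrite !sqnormE dotpDl !dotpDr (dotpC y x); ring. Qed.

Lemma enorm_ge0 x : 0 <= enorm x.
Proof. exact: sqrtr_ge0. Qed.

Lemma sqr_enorm x : enorm x ^+ 2 = sqnorm x.
Proof. by rewrite sqr_sqrtr// sqnorm_ge0. Qed.

Lemma enormZ c x : enorm (c *: x) = `|c| * enorm x.
Proof. by rewrite /enorm sqnormZ sqrtrM ?sqr_ge0// sqrtr_sqr. Qed.

Lemma coord_le_sqnorm x j : x 0 j ^+ 2 <= sqnorm x.
Proof.
rewrite /sqnorm (bigD1 j)//= lerDl; apply: sumr_ge0 => k _; exact: sqr_ge0.
Qed.

Lemma coord_le_enorm x j : `|x 0 j| <= enorm x.
Proof. by rewrite -sqrtr_sqr; exact/ler_wsqrtr/coord_le_sqnorm. Qed.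

(** Expand [0 <= sqnorm (c *: x - y)] and divide by [c]. *)
Lemma young c x y : 0 < c -> 2 * dotp x y <= c * sqnorm x + c^-1 * sqnorm y.
Proof.
move=> c0; have := sqnorm_ge0 (c *: x + (-1) *: y).
rewrite sqnormD !sqnormZ dotpZl dotpZr => h.
have cE : c * sqnorm x + c^-1 * sqnorm y - 2 * dotp x y =
    c^-1 * (c ^+ 2 * sqnorm x + 2 * (c * (-1 * dotp x y)) +
            (-1) ^+ 2 * sqnorm y) by field; rewrite gt_eqF.
by rewrite -subr_ge0 cE mulr_ge0// invr_ge0 ltW.
Qed.

Lemma enorm_eq0 x : enorm x = 0 -> x = 0.
Proof.
move=> x0; apply/rowP => j; rewrite mxE; apply/eqP.
by rewrite -normr_le0 -x0 coord_le_enorm.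
Qed.

(** Young's inequality with [c = enorm y / enorm x], the weight that balances both terms; vanishing
    norms are treated separately. *)
Lemma cauchy_schwarz x y : dotp x y <= enorm x * enorm y.
Proof.
have [/enorm_eq0 ->|x0] := eqVneq (enorm x) 0.
  by rewrite dotp0l mulr_ge0// enorm_ge0.
have [/enorm_eq0 ->|y0] := eqVneq (enorm y) 0.
  by rewrite dotpC dotp0l mulr_ge0// enorm_ge0.
have px : 0 < enorm x by rewrite lt_def x0 enorm_ge0.
have py : 0 < enorm y by rewrite lt_def y0 enorm_ge0.
have := young x y (divr_gt0 py px).
rewrite -!sqr_enorm (_ : _ + _ = 2 * (enorm x * enorm y)).
  by rewrite ler_pM2l.
by field; rewrite x0 y0.
Qed.

Lemma enorm_continuous : continuous (@enorm R n).
Proof.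
move=> x; apply: (continuous_comp (f := @sqnorm R n) (g := Num.sqrt)).
  apply: differentiable_continuous.
  rewrite (_ : @sqnorm R n =
      \sum_(j < n) (fun y : 'rV[R]_n => y 0 j) ^+ 2).
    apply: differentiable_sum => j; apply: differentiableX.
    exact: differentiable_coord.
  by apply/funext => y; rewrite fct_sumE.
exact: sqrt_continuous.
Qed.

(** The topology on row vectors comes from the sup norm while the Lipschitz bound is Euclidean;
    continuity of [enorm] bridges the two. *)
Lemma lipschitz_coord_continuous (G : 'rV[R]_n -> 'rV[R]_n) L j :
  euclid_lipschitz G L -> continuous (fun x => G x 0 j).
Proof.
move=> GL x; apply/(@cvgrPdist_le _ _ _ (nbhs x) (nbhs_filter x)) => e e0.
have c1 : {for x, continuous (fun y : 'rV[R]_n => enorm (x - y))}.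
  apply: (continuous_comp (f := fun y : 'rV[R]_n => x - y) (g := @enorm R n)).
    by apply: continuousB; [exact: cst_continuous|move=> ?].
  exact: enorm_continuous.
have cL : {for x, continuous (fun y : 'rV[R]_n => L * enorm (x - y))}.
  by apply: continuousM; [exact: cst_continuous|exact: c1].
rewrite /prop_for /continuous_at in cL.
rewrite subrr (_ : enorm 0 = 0) ?mulr0 in cL; last first.
  by rewrite -(scale0r 0) enormZ normr0 mul0r.
move/(@cvgrPdist_le _ _ _ (nbhs x) (nbhs_filter x)) : cL => /(_ e e0); apply: filterS => y.
rewrite sub0r normrN => h; apply: le_trans h.
apply: le_trans (ler_norm _); apply: le_trans (GL x y).
by have := coord_le_enorm (G x - G y) j; rewrite !mxE.
Qed.

(** Subtract the quadratic model along the segment from [x] to [x + h]. The difference [phi] has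
    derivative [dotp (G (x + t *: h) - G x) h - L * t * sqnorm h], which is nonpositive by
    Cauchy-Schwarz and the Lipschitz bound, so [phi 1 <= phi 0]. *)
Lemma descent (F : 'rV[R]_n -> R) (G : 'rV[R]_n -> 'rV[R]_n) L x h :
  is_gradient F G -> euclid_lipschitz G L ->
  F (x + h) <= F x + dotp (G x) h + L / 2 * sqnorm h.
Proof.
move=> FG GL.
pose l (t : R) := x + t *: h.
have dl t : is_diff t l ( *:%R^~ h).
  by apply: is_diff_eq; rewrite add0r.
have dFl t : is_derive t (1:R) (F \o l) (dotp (G (l t)) h).
  have [dF dE] := FG (l t).
  have dFl : differentiable (F \o l) t.
    exact: differentiable_comp.
  split; first exact: diff_derivable.
  rewrite deriveE// diff_comp//.
  by rewrite /= dE diff_val scale1r.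
pose a := dotp (G x) h; pose b := L / 2 * sqnorm h.
pose phi (t : R) := (F \o l) t - (a * t + b * (t * t)).
have dphi t : is_derive t (1:R) phi (dotp (G (l t)) h - (a + b * (2 * t))).
  by apply: is_derive_eq; rewrite /GRing.scale/=; ring.
have H := @ler0_derive1_le_cc R phi 0 1.
have : phi 1 <= phi 0.
  apply: H => //; rewrite ?in_itv/= ?lexx ?ler01//.
  - move=> t; rewrite in_itv/= => /andP[t0 t1]; rewrite derive1E derive_val.
    have : dotp (G (l t) - G x) h <= L * t * sqnorm h.
      apply: le_trans (cauchy_schwarz _ _) _.
      apply: le_trans (ler_wpM2r (enorm_ge0 h) (GL _ _)) _.
      rewrite /l addrC addKr enormZ gtr0_norm// -sqr_enorm expr2.
      by rewrite !mulrA.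
    rewrite dotpDl -scaleN1r dotpZl /a /b; lra.
  - apply: derivable_within_continuous => t _; exact: ex_derive.
rewrite /phi /= /l scale0r scale1r addr0 /a /b; lra.
Qed.

End Euclidean.

Section Average.
Context (R : realType) (m n : nat).

Lemma favg_gradient (f : 'I_m -> 'rV[R]_n -> R) (g : 'I_m -> 'rV[R]_n -> 'rV[R]_n) :
  (forall i, is_gradient (f i) (g i)) -> is_gradient (favg f) (gavg g).
Proof.
move=> fg x.
have sum_diff (r : seq 'I_m) : is_diff x (fun y => \sum_(i <- r) f i y)
    (dotp (\sum_(i <- r) g i x)).
  elim: r => [|i r IH].
    under eq_fun do rewrite big_nil; rewrite big_nil.
    apply: is_diff_eq; apply/funext => z.
    by rewrite dotp0l.
  under eq_fun do rewrite big_cons; rewrite big_cons.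
  have [df dE] := fg i x.
  have di : is_diff x (f i) (dotp (g i x)) by split.
  rewrite (_ : dotp _ = dotp (g i x) + dotp (\sum_(i <- r) g i x)).
    exact: is_diffD.
  by apply/funext => z; rewrite dotpDl.
have : is_diff x (favg f) (dotp (gavg g x)).
  rewrite (_ : dotp _ = m%:R^-1 *: dotp (\sum_i g i x)).
    exact: is_diffZ.
  by apply/funext => z; rewrite dotpZl.
by case.
Qed.

End Average.

(** * Integrability *)

Section Integrability.
Context (R : realType) (d : measure_display) (T : measurableType d)
  (P : probability T R).
Implicit Types X Y : T -> R.

Definition rintegrable X := P.-integrable setT (EFin \o X).

Lemma rintegrable_measurable X : rintegrable X -> measurable_fun setT X.
Proof. by move=> /integrableP[/measurable_EFinP]. Qed.

Lemma rintegrable_cst c : rintegrable (cst c).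
Proof. exact: finite_measure_integrable_cst. Qed.

Lemma rintegrableD X Y : rintegrable X -> rintegrable Y ->
  rintegrable (fun w => X w + Y w).
Proof. by move=> iX iY; have := integrableD measurableT iX iY. Qed.

Lemma rintegrableZ c X : rintegrable X -> rintegrable (fun w => c * X w).
Proof. by move=> iX; have := integrableZl measurableT c iX. Qed.

Lemma rintegrable_sum (I : Type) (r : seq I) (X : I -> T -> R) :
  (forall i, rintegrable (X i)) -> rintegrable (fun w => \sum_(i <- r) X i w).
Proof.
move=> iX; elim: r => [|i r IH].
  by under eq_fun do rewrite big_nil; exact: rintegrable_cst.
by under eq_fun do rewrite big_cons; exact: rintegrableD.
Qed.

Lemma Rintegral_sum (I : Type) (r : seq I) (X : I -> T -> R) :
  (forall i, rintegrable (X i)) ->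
  \int[P]_w (\sum_(i <- r) X i w) = \sum_(i <- r) \int[P]_w X i w.
Proof.
move=> iX; elim: r => [|i r IH].
  under eq_Rintegral do rewrite big_nil.
  by rewrite big_nil Rintegral_cst// mul0r.
under eq_Rintegral do rewrite big_cons.
rewrite big_cons RintegralD ?IH//; first exact: iX.
exact (rintegrable_sum r iX).
Qed.

Lemma Rintegral_prob_cst c : \int[P]_w c = c.
Proof.
transitivity (c * fine (P setT)); first exact: Rintegral_cst.
by rewrite probability_setT mulr1.
Qed.

Lemma rintegrable_le X Y : measurable_fun setT X -> rintegrable Y ->
  (forall w, `|X w| <= Y w) -> rintegrable X.
Proof.
move=> mX iY XY; apply: le_integrable iY => //; first exact/measurable_EFinP.
by move=> w _ /=; rewrite lee_fin; exact: le_trans (XY w) (ler_norm _).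
Qed.

Lemma rintegrableE X : rintegrable X ->
  (\int[P]_w (X w)%:E)%E = (\int[P]_w X w)%:E.
Proof. by move=> iX; rewrite /Rintegral fineK//; exact: integrable_fin_num. Qed.

(** Passes from an extended-real bound, the form in which the error assumption is given, to
    integrability and a bound between reals. *)
Lemma rintegrable_bounded X M : measurable_fun setT X -> (forall w, 0 <= X w) ->
  (\int[P]_w (X w)%:E <= M%:E)%E -> rintegrable X /\ \int[P]_w X w <= M.
Proof.
move=> mX X0 XM.
have iX : rintegrable X.
  apply/integrableP; split; first exact/measurable_EFinP.
  under eq_integral do rewrite gee0_abs ?lee_fin//.
  by apply: le_lt_trans XM _; rewrite ltry.
by split=> //; rewrite -lee_fin -rintegrableE.
Qed.

(** The product is dominated by [X ^+ 2 + Y ^+ 2], as the squares of [X + Y] and [X - Y] are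
    nonnegative. *)
Lemma rintegrable_mul X Y : measurable_fun setT X -> measurable_fun setT Y ->
  rintegrable (fun w => X w ^+ 2) -> rintegrable (fun w => Y w ^+ 2) ->
  rintegrable (fun w => X w * Y w).
Proof.
move=> mX mY iX iY; apply: rintegrable_le (rintegrableD iX iY) _.
  exact: measurable_funM.
move=> w; rewrite ler_norml.
have h1 := sqr_ge0 (X w + Y w); have h2 := sqr_ge0 (X w - Y w).
have h3 := sqr_ge0 (X w); have h4 := sqr_ge0 (Y w).
apply/andP; split; nra.
Qed.

Lemma rintegrable_sqrD X Y : measurable_fun setT X -> measurable_fun setT Y ->
  rintegrable (fun w => X w ^+ 2) -> rintegrable (fun w => Y w ^+ 2) ->
  rintegrable (fun w => (X w + Y w) ^+ 2).
Proof.
move=> mX mY iX iY.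
apply: rintegrable_le (rintegrableZ 2 (rintegrableD iX iY)) _.
  by apply: measurable_funX; exact: measurable_funD.
move=> w; rewrite ger0_norm ?sqr_ge0//.
have h2 := sqr_ge0 (X w - Y w); nra.
Qed.

Lemma rintegrable_sqrZ c X : rintegrable (fun w => X w ^+ 2) ->
  rintegrable (fun w => (c * X w) ^+ 2).
Proof.
by move=> iX; under eq_fun do rewrite exprMn; exact: rintegrableZ.
Qed.

Lemma rintegrable_sqrW X : measurable_fun setT X ->
  rintegrable (fun w => X w ^+ 2) -> rintegrable X.
Proof.
move=> mX iX; rewrite (_ : X = fun w => X w * cst 1 w).
  by apply: rintegrable_mul => //; exact: (rintegrable_cst (1 ^+ 2)).
by apply/funext => w; rewrite mulr1.
Qed.

Section Vectors.
Context (n : nat).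
Implicit Types U V : T -> 'rV[R]_n.

Definition square_integrable U :=
  (forall j, measurable_fun setT (fun w => U w 0 j)) /\
  (forall j, rintegrable (fun w => U w 0 j ^+ 2)).

Lemma square_integrable_dotp U V : square_integrable U -> square_integrable V ->
  rintegrable (fun w => dotp (U w) (V w)).
Proof.
by move=> [mU iU] [mV iV]; apply: rintegrable_sum => j; exact: rintegrable_mul.
Qed.

Lemma square_integrable_sqnorm U : square_integrable U ->
  rintegrable (fun w => sqnorm (U w)).
Proof.
by move=> iU; under eq_fun do rewrite sqnormE; exact: square_integrable_dotp.
Qed.

Lemma square_integrable_cst (u : 'rV[R]_n) : square_integrable (cst u).
Proof. by split => j; [exact: measurable_cst|exact: (rintegrable_cst (u 0 j ^+ 2))]. Qed.

Lemma square_integrableD U V : square_integrable U -> square_integrable V ->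
  square_integrable (fun w => U w + V w).
Proof.
move=> [mU iU] [mV iV]; split => j; under eq_fun do rewrite mxE.
  exact: measurable_funD.
exact: rintegrable_sqrD.
Qed.

Lemma square_integrableZ c U : square_integrable U ->
  square_integrable (fun w => c *: U w).
Proof.
move=> [mU iU]; split => j; under eq_fun do rewrite mxE.
  exact: measurable_funM.
exact: rintegrable_sqrZ.
Qed.

Lemma square_integrable_of_sqnorm U :
  (forall j, measurable_fun setT (fun w => U w 0 j)) ->
  rintegrable (fun w => sqnorm (U w)) -> square_integrable U.
Proof.
move=> mU iU; split => // j; apply: rintegrable_le iU _.
  exact: measurable_funX.
by move=> w; rewrite ger0_norm ?sqr_ge0 ?coord_le_sqnorm.
Qed.

Lemma measurable_sqnorm U : (forall j, measurable_fun setT (fun w => U w 0 j)) ->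
  measurable_fun setT (fun w => sqnorm (U w)).
Proof. by move=> mU; apply: measurable_sum => j; exact: measurable_funX. Qed.

(** A Lipschitz map grows at most linearly: [sqnorm (G u)] is at most
    [2 * L ^+ 2 * sqnorm u + 2 * sqnorm (G 0)]. *)
Lemma square_integrable_lipschitz (G : 'rV[R]_n -> 'rV[R]_n) L U :
  euclid_lipschitz G L -> square_integrable U ->
  square_integrable (fun w => G (U w)).
Proof.
move=> GL iU.
have mGU j : measurable_fun setT (fun w => G (U w) 0 j).
  apply: (continuous_coord_measurable (h := fun x => G x 0 j)); last exact: iU.1.
  exact: lipschitz_coord_continuous GL.
apply: square_integrable_of_sqnorm => //.
pose c := 2 * sqnorm (G 0).
apply: (@rintegrable_le _ (fun w => 2 * L ^+ 2 * sqnorm (U w) + c)).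
- exact: measurable_sqnorm.
- apply: rintegrableD; last exact: rintegrable_cst.
  by apply: rintegrableZ; exact: square_integrable_sqnorm.
- move=> w; rewrite ger0_norm ?sqnorm_ge0//.
  have h1 : sqnorm (G (U w) - G 0) <= L ^+ 2 * sqnorm (U w).
    have := GL (U w) 0; rewrite subr0 => h.
    rewrite -!sqr_enorm -exprMn ler_sqr// nnegrE ?enorm_ge0//.
    exact: le_trans (enorm_ge0 _) h.
  have := young (G (U w) - G 0) (G 0) (@ltr01 R); rewrite invr1 => h2.
  rewrite -[X in sqnorm X](subrK (G 0)) sqnormD /c; lra.
Qed.

End Vectors.

End Integrability.

(** * Moments along the iterates *)

Section Moments.
Context (R : realType) (d : measure_display) (Omega : measurableType d)
  (P : probability Omega R) (m : nat) (v : nat -> 'I_m -> {RV P >-> R}).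

Let vp (p : nat * 'I_m) : {RV P >-> R} := v p.1 p.2.

Definition before (k : nat) : set (nat * 'I_m) := [set p | (p.1 < k)%N].

Notation historyType S := (g_sigma_algebraType (cylinders vp S)).

(** Measurability with respect to the samples drawn strictly before step [k], hence independence
    from every entry of the sample of step [k]. *)
Definition adapted (k : nat) (Y : Omega -> R) :=
  measurable_fun (setT : set (historyType (before k)))
    (Y : historyType (before k) -> R).

Hypothesis Hindep : mutually_independent vp.
Hypothesis Hlaw : forall k i, same_law (v k i) (v 0 i).
Hypothesis Hmean : forall i, ('E_P[v 0%N i] = 1%:E)%E.
Hypothesis Hsq : forall i, P.-integrable setT (fun w => (v 0 i w ^+ 2)%:E).

(** Both integrals are integrals of [h] against one common law; integrability is transferred first,
    through [|h|]. *)
Lemma same_law_integral (X Y : {RV P >-> R}) (h : R -> R) :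
  measurable_fun setT h -> same_law X Y -> rintegrable P (h \o Y) ->
  rintegrable P (h \o X) /\ \int[P]_w h (X w) = \int[P]_w h (Y w).
Proof.
move=> mh XY ihY.
have mhX : measurable_fun setT (h \o X) by exact: measurableT_comp.
have eq_d (u : R -> \bar R) :
    (\int[distribution P X]_x u x = \int[distribution P Y]_x u x)%E.
  by apply: eq_measure_integral => A mA _; rewrite /= /pushforward; exact: XY.
have mEh : measurable_fun setT (EFin \o h) by exact/measurable_EFinP.
have ihX : rintegrable P (h \o X).
  apply/integrableP; split; first exact/measurable_EFinP.
  have h1 := @ge0_integral_distribution _ _ _ _ _ P X (abse \o (EFin \o h)).
  have h2 := @ge0_integral_distribution _ _ _ _ _ P Y (abse \o (EFin \o h)).
  have mabs : measurable_fun setT (abse \o (EFin \o h)) by exact: measurableT_comp.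
  have abs0 y : (0 <= (abse \o (EFin \o h)) y)%E by exact: abse_ge0.
  have := h1 mabs abs0; rewrite eq_d (h2 mabs abs0) => hXY.
  by have /integrableP[_] := ihY; rewrite [X in (X < _)%E]hXY.
split=> //; congr fine.
have h1 := @integral_distribution _ _ _ _ _ P X (EFin \o h) mEh ihX.
have h2 := @integral_distribution _ _ _ _ _ P Y (EFin \o h) mEh ihY.
by rewrite -[LHS]h1 eq_d h2.
Qed.

Lemma v0_rintegrable i : rintegrable P (v 0%N i).
Proof. by apply: rintegrable_sqrW => //; exact: Hsq. Qed.

Lemma v_mean k i : rintegrable P (v k i) /\ \int[P]_w v k i w = 1.
Proof.
have [] := @same_law_integral (v k i) (v 0%N i) id _ (Hlaw k i) (v0_rintegrable i) => //.
move=> ivk ->; split => //.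
by have := Hmean i; rewrite unlock /Rintegral => ->.
Qed.

(* E[v_i v_i'], the entries being independent with mean 1. *)
Definition second_moment (i i' : 'I_m) : R :=
  if i == i' then \int[P]_w (v 0%N i w ^+ 2) else 1.

Lemma adapted_measurable k Y : adapted k Y -> measurable_fun setT Y.
Proof. exact: cylinder_measurable_fun. Qed.

Lemma adapted_first_moment k i Y : adapted k Y -> rintegrable P Y ->
  rintegrable P (fun w => v k i w * Y w) /\
  \int[P]_w (v k i w * Y w) = \int[P]_w Y w.
Proof.
move=> aY iY.
have nk : ~ before k (k, i) by rewrite /before /= ltnn.
have [ivk vk1] := v_mean k i.
have [] := cylinder_integral (X := vp) (p := (k, i)) (h := id) Hindep nk _ aY ivk iY.
  by [].
by move=> i1 ->; split => //; rewrite [X in X * _]vk1 mul1r.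
Qed.

(** On the diagonal, the square of one entry is independent of the past. Off the diagonal the two
    entries are integrated out one after the other, each with mean 1. *)
Lemma adapted_second_moment k i i' Y : adapted k Y -> rintegrable P Y ->
  rintegrable P (fun w => v k i w * v k i' w * Y w) /\
  \int[P]_w (v k i w * v k i' w * Y w) = second_moment i i' * \int[P]_w Y w.
Proof.
move=> aY iY; rewrite /second_moment.
have nk : ~ before k (k, i) by rewrite /before /= ltnn.
have [<-|ii'] := eqVneq i i'.
  have msq : measurable_fun setT (fun x : R => x ^+ 2) by exact: measurable_funX.
  have [ivk2 vk2] := same_law_integral msq (Hlaw k i) (Hsq i).
  have [i1 i2] := cylinder_integral (X := vp) (p := (k, i))
    (h := fun x => x ^+ 2) Hindep nk msq aY ivk2 iY.
  rewrite (_ : (fun w => v k i w * v k i w * Y w) =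
      fun w => v k i w ^+ 2 * Y w); first by rewrite -vk2.
  by apply/funext => w; rewrite expr2.
(* The history is enlarged by the entry [i'] of the current sample; [v k i] is still independent of
   it because [i] differs from [i']. *)
pose S := before k `|` [set (k, i')].
have nS : ~ S (k, i).
  move=> [|]; first exact: nk.
  by move=> [] /eqP; rewrite (negbTE ii').
have [i1 e1] := adapted_first_moment i' aY iY.
have [ivk vk1] := v_mean k i.
have mS : measurable_fun (setT : set (historyType S))
    ((fun w => v k i' w * Y w) : historyType S -> R).
  apply: measurable_funM.
    by apply: (@cylinder_measurable_coord _ _ _ P _ vp S (k, i')); right.
  by apply: cylinder_measurable_funS aY => p; left.
have [i2 e2] := cylinder_integral (X := vp) (p := (k, i)) (h := id) Hindep nS
  (@measurable_id _ _ _) mS ivk i1.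
rewrite (_ : (fun w => v k i w * v k i' w * Y w) =
    fun w => v k i w * (v k i' w * Y w)).
  by split=> //; rewrite [LHS]e2 [X in X * _]vk1 e1.
by apply/funext => w; rewrite mulrA.
Qed.

Section Gradient.
Context (n : nat) (g : 'I_m -> 'rV[R]_n -> 'rV[R]_n).

(* The value of E|grad f_v(x)|^2. *)
Definition mean_sqgrad (x : 'rV[R]_n) : R :=
  \sum_i \sum_i' m%:R^-1 ^+ 2 * second_moment i i' * dotp (g i x) (g i' x).

Lemma dotp_suml (I : Type) (r : seq I) (F : I -> 'rV[R]_n) (y : 'rV[R]_n) :
  dotp (\sum_(i <- r) F i) y = \sum_(i <- r) dotp (F i) y.
Proof.
elim: r => [|i r IH]; first by rewrite !big_nil dotp0l.
by rewrite !big_cons dotpDl IH.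
Qed.

Lemma dotp_sumr (I : Type) (r : seq I) (F : I -> 'rV[R]_n) (y : 'rV[R]_n) :
  dotp y (\sum_(i <- r) F i) = \sum_(i <- r) dotp y (F i).
Proof. by rewrite dotpC dotp_suml; apply: eq_bigr => i _; rewrite dotpC. Qed.

Lemma sqnorm_gradv (u : 'rV[R]_m) x : sqnorm (gradv g u x) =
  \sum_i \sum_i' m%:R^-1 ^+ 2 * (u 0 i * u 0 i' * dotp (g i x) (g i' x)).
Proof.
rewrite /gradv sqnormZ sqnormE dotp_suml mulr_sumr; apply: eq_bigr => i _.
rewrite dotp_sumr mulr_sumr; apply: eq_bigr => i' _.
by rewrite dotpZl dotpZr; ring.
Qed.

Variables (k : nat) (th : Omega -> 'rV[R]_n).
Hypothesis ath : forall i i', adapted k (fun w => dotp (g i (th w)) (g i' (th w))).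
Hypothesis ith : forall i, square_integrable P (fun w => g i (th w)).

(** Expand the square bilinearly and apply the second moment formula to each pair of indices. The
    point [th] is abstract so that the result serves both the iterate and a constant. *)
Lemma sqnorm_gradv_integral :
  rintegrable P (fun w => sqnorm (gradv g (vrow v k w) (th w))) /\
  \int[P]_w sqnorm (gradv g (vrow v k w) (th w)) = \int[P]_w mean_sqgrad (th w).
Proof.
have mom i i' := adapted_second_moment i i' (ath i i')
  (square_integrable_dotp (ith i) (ith i')).
have sqE : (fun w => sqnorm (gradv g (vrow v k w) (th w))) = fun w =>
    \sum_i \sum_i' m%:R^-1 ^+ 2 *
      (v k i w * v k i' w * dotp (g i (th w)) (g i' (th w))).
  apply/funext => w; rewrite sqnorm_gradv.
  by apply: eq_bigr => i _; apply: eq_bigr => i' _; rewrite !mxE.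
have i1 i i' : rintegrable P (fun w => m%:R^-1 ^+ 2 *
    (v k i w * v k i' w * dotp (g i (th w)) (g i' (th w)))).
  by apply: rintegrableZ; exact: (mom i i').1.
have i2 i i' : rintegrable P (fun w =>
    m%:R^-1 ^+ 2 * second_moment i i' * dotp (g i (th w)) (g i' (th w))).
  by apply: rintegrableZ; exact: square_integrable_dotp.
split.
  by rewrite sqE; apply: rintegrable_sum => i; exact: rintegrable_sum.
rewrite sqE /mean_sqgrad !Rintegral_sum; last 2 first.
  by move=> i; exact: rintegrable_sum.
  by move=> i; exact: rintegrable_sum.
apply: eq_bigr => i _; rewrite !Rintegral_sum//; apply: eq_bigr => i' _.
rewrite RintegralZl//; last exact: (mom i i').1.
rewrite RintegralZl//; last exact: square_integrable_dotp.
by rewrite (mom i i').2 mulrA.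
Qed.

(** Unbiasedness of the stochastic gradient, tested against [gavg g (th w)], which depends only on
    the past. *)
Lemma dotp_gradv_integral :
  rintegrable P (fun w => dotp (gavg g (th w)) (gradv g (vrow v k w) (th w))) /\
  \int[P]_w dotp (gavg g (th w)) (gradv g (vrow v k w) (th w)) =
  \int[P]_w sqnorm (gavg g (th w)).
Proof.
pose Y i w := dotp (gavg g (th w)) (g i (th w)).
have YE i : Y i = fun w => \sum_i' m%:R^-1 * dotp (g i' (th w)) (g i (th w)).
  by apply/funext => w; rewrite /Y /gavg dotpZl dotp_suml mulr_sumr.
have aY i : adapted k (Y i).
  rewrite YE; apply: measurable_sum => i'; apply: measurable_funM => //.
  exact: ath.
have iY i : rintegrable P (Y i).
  rewrite YE; apply: rintegrable_sum => i'; apply: rintegrableZ.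
  exact: square_integrable_dotp.
have mom i := adapted_first_moment i (aY i) (iY i).
have gE : (fun w => dotp (gavg g (th w)) (gradv g (vrow v k w) (th w))) =
    fun w => \sum_i m%:R^-1 * (v k i w * Y i w).
  apply/funext => w; rewrite /gradv dotpZr dotp_sumr mulr_sumr.
  by apply: eq_bigr => i _; rewrite dotpZr mxE.
have sE : (fun w => sqnorm (gavg g (th w))) =
    fun w => \sum_i m%:R^-1 * Y i w.
  apply/funext => w; rewrite sqnormE {2}/gavg dotpZr dotp_sumr mulr_sumr.
  by [].
have i1 i : rintegrable P (fun w => m%:R^-1 * (v k i w * Y i w)).
  by apply: rintegrableZ; exact: (mom i).1.
rewrite gE sE; split; first exact: rintegrable_sum.
rewrite !Rintegral_sum//; last by move=> i; exact: rintegrableZ.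
apply: eq_bigr => i _; rewrite RintegralZl//; last exact: (mom i).1.
by rewrite RintegralZl ?(mom i).2//; exact: iY.
Qed.

End Gradient.

(** * Adaptedness and square integrability of the iterates *)

Section Iterates.
Context (n : nat) (g : 'I_m -> 'rV[R]_n -> 'rV[R]_n)
  (e : nat -> 'rV[R]_m -> 'rV[R]_n -> 'rV[R]_n)
  (theta0 : 'rV[R]_n) (alpha eps : nat -> R).

Notation th := (isgd g e v alpha theta0).
Notation grad k w := (gradv g (vrow v k w) (th k w)).
Notation err k w := (e k (vrow v k w) (th k w)).

Hypothesis Hlipi : forall i, exists Li : R, euclid_lipschitz (g i) Li.
Hypothesis He_meas :
  forall k, borel_map (fun p : 'rV[R]_m * 'rV[R]_n => e k p.1 p.2).
Hypothesis HA2 : forall k,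
  (\int[P]_w (sqnorm (err k w))%:E <= (eps k ^+ 2)%:E)%E.

Lemma adaptedS k Y : adapted k Y -> adapted k.+1 Y.
Proof. by apply: cylinder_measurable_funS => p; exact: leqW. Qed.

Lemma adapted_v k i : adapted k.+1 (v k i).
Proof. exact: (@cylinder_measurable_coord _ _ _ P _ vp _ (k, i)) (ltnSn k). Qed.

Lemma grad_coordE k w j :
  grad k w 0 j = m%:R^-1 * \sum_i v k i w * g i (th k w) 0 j.
Proof. by rewrite !mxE summxE; under eq_bigr do rewrite !mxE. Qed.

Lemma isgd_coordE k w j :
  th k.+1 w 0 j = th k w 0 j + (- alpha k) * (grad k w 0 j + err k w 0 j).
Proof. by rewrite /= !mxE mulNr. Qed.

Lemma g_adapted k i j : (forall l, adapted k (fun w => th k w 0 l)) ->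
  adapted k (fun w => g i (th k w) 0 j).
Proof.
move=> ath; have [L gL] := Hlipi i.
apply: (continuous_coord_measurable (h := fun x => g i x 0 j)) => //.
exact: lipschitz_coord_continuous gL.
Qed.

(** The error is a jointly Borel function of sample and iterate, so it suffices that this pair is
    measurable for the history up to and including step [k]. *)
Lemma err_adapted k j : (forall l, adapted k (fun w => th k w 0 l)) ->
  adapted k.+1 (fun w => err k w 0 j).
Proof.
move=> ath.
have mp : borel_measurable (fun w : historyType (before k.+1) =>
    (vrow v k w, th k w)).
  apply: coord_borel_measurable_pair => i; last exact: adaptedS.
  by under eq_fun do rewrite mxE; exact: adapted_v.
exact (borel_measurable_coord j (borel_map_measurable (He_meas k) mp)).
Qed.

Lemma grad_adapted k j : (forall l, adapted k (fun w => th k w 0 l)) ->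
  adapted k.+1 (fun w => grad k w 0 j).
Proof.
move=> ath; rewrite /adapted; under eq_fun do rewrite grad_coordE.
apply: measurable_funM => //; apply: measurable_sum => i.
apply: measurable_funM; first exact: adapted_v.
by apply: adaptedS; exact: g_adapted.
Qed.

Lemma isgd_adapted k j : adapted k (fun w => th k w 0 j).
Proof.
elim: k j => [|k IH] j; first exact: measurable_cst.
rewrite /adapted; under eq_fun do rewrite isgd_coordE.
apply: measurable_funD; first exact: adaptedS.
apply: measurable_funM => //; apply: measurable_funD.
  exact: grad_adapted.
exact: err_adapted.
Qed.

Lemma err_integrable k : square_integrable P (fun w => err k w) /\
  \int[P]_w sqnorm (err k w) <= eps k ^+ 2.
Proof.
have merr j : measurable_fun setT (fun w => err k w 0 j).
  by apply: adapted_measurable; apply: err_adapted => l; exact: isgd_adapted.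
have [] := rintegrable_bounded (measurable_sqnorm merr) _ (HA2 k).
  by move=> w; exact: sqnorm_ge0.
by move=> ierr bound; split => //; exact: square_integrable_of_sqnorm.
Qed.

Lemma dotp_g_adapted k i i' :
  adapted k (fun w => dotp (g i (th k w)) (g i' (th k w))).
Proof.
apply: measurable_sum => j.
by apply: measurable_funM; apply: g_adapted => l; exact: isgd_adapted.
Qed.

Lemma g_square_integrable k i : square_integrable P (fun w => th k w) ->
  square_integrable P (fun w => g i (th k w)).
Proof. by have [L gL] := Hlipi i; exact: square_integrable_lipschitz gL. Qed.

Lemma grad_square_integrable k : square_integrable P (fun w => th k w) ->
  square_integrable P (fun w => grad k w).
Proof.
move=> ith; apply: square_integrable_of_sqnorm.
  move=> j; apply: adapted_measurable; apply: grad_adapted => l.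
  exact: isgd_adapted.
have igth i := g_square_integrable i ith.
by have [] := sqnorm_gradv_integral (@dotp_g_adapted k) igth.
Qed.

(** By induction. The stochastic gradient multiplies random entries by functions of the iterate, and
    its square integrability rests on their independence. *)
Lemma isgd_square_integrable k : square_integrable P (fun w => th k w).
Proof.
elim: k => [|k IH]; first exact: square_integrable_cst.
rewrite (_ : (fun w => th k.+1 w) = fun w =>
  th k w + - alpha k *: (grad k w + err k w)); last first.
  by apply/funext => w /=; rewrite scaleNr.
apply: square_integrableD => //; apply: square_integrableZ.
apply: square_integrableD; last exact: (err_integrable k).1.
exact: grad_square_integrable.
Qed.

(** * Descent in expectation *)

Section Descent.
Context (f : 'I_m -> 'rV[R]_n -> R) (L finf A B C eta zeta : R).
Hypothesis Hgrad : forall i, is_gradient (f i) (g i).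
Hypothesis HL : euclid_lipschitz (gavg g) L.
Hypothesis L0 : 0 <= L.
Hypothesis Hfinf : forall x, finf <= favg f x.
Hypothesis HABC : forall x,
  (\int[P]_w (sqnorm (gradv g (vrow v 0 w) x))%:E
   <= (2 * A * (favg f x - finf) + B * sqnorm (gavg g x) + C)%:E)%E.
Hypothesis Hpos : forall k, 0 < alpha k.
Hypothesis Heta : 0 < eta.
Hypothesis Hzeta : 0 < zeta.

Definition gap k := \int[P]_w (favg f (th k w) - finf).
Definition meangrad k := \int[P]_w sqnorm (gavg g (th k w)).

(** At a constant point [mean_sqgrad] is the second moment of the stochastic gradient, so the ABC
    bound applies. The resulting inequality is deterministic in [x] and can be evaluated at a random
    iterate, which takes the place of conditioning. *)
Lemma mean_sqgrad_le x :
  mean_sqgrad g x <= 2 * A * (favg f x - finf) + B * sqnorm (gavg g x) + C.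
Proof.
have ax i i' : adapted 0 (fun w => dotp (g i (cst x w)) (g i' (cst x w))).
  exact: (measurable_cst (dotp (g i x) (g i' x))).
have ix i : square_integrable P (fun w => g i (cst x w)).
  exact: (square_integrable_cst P (g i x)).
have [igrad gradE] := sqnorm_gradv_integral ax ix.
have := HABC x; rewrite rintegrableE// lee_fin.
have cE : \int[P]_w mean_sqgrad g (cst x w) = mean_sqgrad g x.
  exact: (Rintegral_prob_cst P (mean_sqgrad g x)).
by rewrite [X in X <= _ -> _]gradE cE.
Qed.

Lemma gavg_square_integrable k : square_integrable P (fun w => gavg g (th k w)).
Proof. exact: square_integrable_lipschitz HL (isgd_square_integrable k). Qed.

(** The gap is nonnegative, and the descent lemma based at [theta0] dominates it by an integrable
    quadratic in the iterate. *)
Lemma gap_integrable k : rintegrable P (fun w => favg f (th k w) - finf).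
Proof.
have fg := favg_gradient Hgrad.
have mth j : measurable_fun setT (fun w => th k w 0 j).
  by have [] := isgd_square_integrable k.
have mF : measurable_fun setT (fun w => favg f (th k w) - finf).
  apply: measurable_funB => //; apply: continuous_coord_measurable mth => x.
  by apply: differentiable_continuous; have [] := fg x.
have iD : square_integrable P (fun w => th k w + - theta0).
  apply: square_integrableD; first exact: isgd_square_integrable.
  exact: square_integrable_cst.
pose Y w := (favg f theta0 - finf) + dotp (gavg g theta0) (th k w + - theta0) +
  L / 2 * sqnorm (th k w + - theta0).
apply: (@rintegrable_le _ _ _ P _ Y) => //.
  apply: rintegrableD; last first.
    by apply: rintegrableZ; exact: square_integrable_sqnorm.
  apply: rintegrableD; first exact: rintegrable_cst.
  by apply: square_integrable_dotp => //; exact: square_integrable_cst.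
move=> w; rewrite ger0_norm ?subr_ge0//.
have := descent theta0 (th k w + - theta0) fg HL.
by rewrite addrC subrK /Y; lra.
Qed.

Lemma descent_step k w :
  favg f (th k.+1 w) - finf <= (favg f (th k w) - finf) +
    (- alpha k) * dotp (gavg g (th k w)) (grad k w) +
    alpha k / (2 * zeta) * sqnorm (gavg g (th k w)) +
    (alpha k * zeta / 2 + L / 2 * alpha k ^+ 2 * (1 + eta)) * sqnorm (err k w) +
    L / 2 * alpha k ^+ 2 * (1 + eta^-1) * sqnorm (grad k w).
Proof.
set u := gavg g (th k w); set a := grad k w; set b := err k w.
have D := descent (th k w) (- alpha k *: (a + b)) (favg_gradient Hgrad) HL.
rewrite (_ : th k w + _ = th k.+1 w) in D; last by rewrite /= scaleNr.
rewrite dotpZr dotpDr (sqnormZ (- alpha k)) sqrrN -/u in D.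
have zi : 0 < zeta^-1 by rewrite invr_gt0.
(* Weight [zeta^-1] on the gradient and [zeta] on the error: the gradient loses only a fraction
   [1 / (2 * zeta)], less than 1 once [zeta] exceeds one half. *)
have Y1 := young u (-1 *: b) zi.
rewrite dotpZr (sqnormZ (-1)) sqrrN expr1n mul1r invrK in Y1.
have ei : 0 < eta^-1 by rewrite invr_gt0.
have Y2 := young a b ei; rewrite invrK in Y2.
have Y1' : alpha k * (2 * (-1 * dotp u b)) <=
    alpha k * (zeta^-1 * sqnorm u + zeta * sqnorm b).
  by rewrite ler_wpM2l// ltW.
have Y2' : L / 2 * alpha k ^+ 2 * sqnorm (a + b) <=
    L / 2 * alpha k ^+ 2 *
      (sqnorm a + (eta^-1 * sqnorm a + eta * sqnorm b) + sqnorm b).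
  apply: ler_wpM2l; first by rewrite mulr_ge0 ?sqr_ge0// divr_ge0.
  by rewrite sqnormD lerD2r lerD2l.
have -> : alpha k / (2 * zeta) = alpha k * zeta^-1 / 2.
  by rewrite invfM mulrA mulrAC.
move: D Y1' Y2'.
move: (favg f (th k.+1 w)) (favg f (th k w)) => F1 F0.
move: (dotp u a) (dotp u b) (sqnorm u) (sqnorm a) (sqnorm b) (sqnorm (a + b)).
move: (zeta^-1) (eta^-1) (alpha k) => zi' ei' al x1 x2 x3 x4 x5 x6.
lra.
Qed.

Lemma expected_descent k : gap k.+1 <= gap k - alpha k * meangrad k +
  alpha k / (2 * zeta) * meangrad k +
  (alpha k * zeta / 2 + L / 2 * alpha k ^+ 2 * (1 + eta)) * eps k ^+ 2 +
  L / 2 * alpha k ^+ 2 * (1 + eta^-1) * (2 * A * gap k + B * meangrad k + C).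
Proof.
have ith := isgd_square_integrable k.
have iF := gap_integrable k.
have iu := square_integrable_sqnorm (gavg_square_integrable k).
have [ierr errE] := err_integrable k.
have ib := square_integrable_sqnorm ierr.
have igth i := g_square_integrable i ith.
have [ia aE] := sqnorm_gradv_integral (@dotp_g_adapted k) igth.
have [iua uaE] := dotp_gradv_integral (@dotp_g_adapted k) igth.
have gE : \int[P]_w mean_sqgrad g (th k w) <=
    2 * A * gap k + B * meangrad k + C.
  have i1 := rintegrableZ (2 * A) iF.
  have i2 := rintegrableZ B iu.
  have i3 := rintegrable_cst P C.
  have -> : 2 * A * gap k + B * meangrad k + C =
      \int[P]_w (2 * A * (favg f (th k w) - finf) +
                B * sqnorm (gavg g (th k w)) + C).
    rewrite RintegralD//; last exact: rintegrableD.
    by rewrite RintegralD// !RintegralZl// Rintegral_prob_cst.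
  apply: le_Rintegral => //; last by move=> w _; exact: mean_sqgrad_le.
    apply: rintegrable_sum => i; apply: rintegrable_sum => i'.
    by apply: rintegrableZ; exact: square_integrable_dotp.
  by apply: rintegrableD => //; exact: rintegrableD.
(* Nonnegativity of the two coefficients [c1] and [c2] allows the moments they multiply to be
   replaced by upper bounds. *)
have c1 : 0 <= L / 2 * alpha k ^+ 2 * (1 + eta^-1).
  rewrite mulr_ge0//; first by rewrite mulr_ge0 ?sqr_ge0// divr_ge0.
  by rewrite addr_ge0// invr_ge0 ltW.
have c2 : 0 <= alpha k * zeta / 2 + L / 2 * alpha k ^+ 2 * (1 + eta).
  rewrite addr_ge0//; first by rewrite divr_ge0// mulr_ge0// ltW.
  rewrite mulr_ge0//; first by rewrite mulr_ge0 ?sqr_ge0// divr_ge0.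
  by rewrite addr_ge0// ltW.
(* The right side of the pointwise descent, built up one summand at a time so that linearity of the
   integral peels the terms off in turn. *)
pose U1 w := (favg f (th k w) - finf) +
    (- alpha k) * dotp (gavg g (th k w)) (grad k w).
pose U2 w := U1 w + alpha k / (2 * zeta) * sqnorm (gavg g (th k w)).
pose U3 w := U2 w +
    (alpha k * zeta / 2 + L / 2 * alpha k ^+ 2 * (1 + eta)) * sqnorm (err k w).
pose U4 w := U3 w + L / 2 * alpha k ^+ 2 * (1 + eta^-1) * sqnorm (grad k w).
have j1 : rintegrable P U1 by apply: rintegrableD => //; exact: rintegrableZ.
have j2 : rintegrable P U2 by apply: rintegrableD => //; exact: rintegrableZ.
have j3 : rintegrable P U3 by apply: rintegrableD => //; exact: rintegrableZ.
have j4 : rintegrable P U4 by apply: rintegrableD => //; exact: rintegrableZ.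
have UE : \int[P]_w U4 w = gap k - alpha k * meangrad k +
    alpha k / (2 * zeta) * meangrad k +
    (alpha k * zeta / 2 + L / 2 * alpha k ^+ 2 * (1 + eta)) *
      \int[P]_w sqnorm (err k w) +
    L / 2 * alpha k ^+ 2 * (1 + eta^-1) * \int[P]_w mean_sqgrad g (th k w).
  rewrite /U4 RintegralD//; last exact: rintegrableZ.
  rewrite /U3 RintegralD//; last exact: rintegrableZ.
  rewrite /U2 RintegralD//; last exact: rintegrableZ.
  rewrite /U1 RintegralD//; last exact: rintegrableZ.
  by rewrite !RintegralZl// uaE aE mulNr.
apply: (@le_trans _ _ (\int[P]_w U4 w)).
  apply: le_Rintegral => //; first exact: gap_integrable.
  by move=> w _; exact: descent_step.
rewrite UE; apply: lerD; last exact: ler_wpM2l.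
by apply: lerD => //; exact: ler_wpM2l.
Qed.

End Descent.
End Iterates.
End Moments.

(** * The scalar recursion *)

Section Recursion.
Context (R : realType) (r G alpha eps : nat -> R) (a c q D S : R).
Hypotheses (a0 : 0 <= a) (c0 : 0 < c) (q0 : 0 <= q) (D0 : 0 <= D).
Hypotheses (r0 : forall k, 0 <= r k) (G0 : forall k, 0 <= G k).
Hypothesis alpha0 : forall k, 0 < alpha k.
Hypothesis sum_alpha : forall K : nat, \sum_(k < K) alpha k ^+ 2 <= S.
Hypothesis step : forall k, r k.+1 <= (1 + a * alpha k ^+ 2) * r k -
  c * (alpha k * G k) + (q * alpha k ^+ 2 + D * (alpha k * eps k ^+ 2)).

(* Gronwall: since 1 + a * alpha k ^ 2 <= exp (a * alpha k ^ 2), square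
   summability keeps the accumulated growth factor bounded by exp (a * S). *)
Lemma recursion_gronwall (K : nat) : r K + c * \sum_(k < K) alpha k * G k <=
  expR (a * \sum_(k < K) alpha k ^+ 2) *
  (r 0%N + \sum_(k < K) (q * alpha k ^+ 2 + D * (alpha k * eps k ^+ 2))).
Proof.
elim: K => [|K IH]; first by rewrite !big_ord0 !mulr0 !addr0 expR0 mul1r.
rewrite !big_ord_recr/= [a * (_ + _)]mulrDr expRD.
set E := expR _ in IH *; set s := \sum_(k < K) alpha k * G k in IH *.
set T := r 0%N + _ in IH; rewrite addrA -/T.
set x := a * alpha K ^+ 2.
have x0 : 0 <= x by rewrite mulr_ge0 ?sqr_ge0.
set b := q * alpha K ^+ 2 + _.
have b0 : 0 <= b.
  apply: addr_ge0; apply: mulr_ge0; rewrite ?sqr_ge0//.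
  by rewrite mulr_ge0 ?sqr_ge0// ltW.
have s0 : 0 <= s by rewrite sumr_ge0// => k _; rewrite mulr_ge0// ltW.
have E1 : 1 <= E.
  rewrite -expR0 ler_expR mulr_ge0// sumr_ge0// => k _; exact: sqr_ge0.
have ex : 1 + x <= expR x by exact: expR_ge1Dx.
have ex1 : 1 <= E * expR x by rewrite mulr_ege1// (le_trans _ ex)// lerDl.
have cs0 : 0 <= c * s by rewrite mulr_ge0// ltW.
have h1 : (1 + x) * (r K + c * s) <= (1 + x) * (E * T).
  by apply: ler_wpM2l => //; rewrite addr_ge0.
have T0 : 0 <= E * T by apply: le_trans IH; rewrite addr_ge0.
have h2 : (1 + x) * (E * T) <= expR x * (E * T) by exact: ler_wpM2r.
have h3 : b <= E * expR x * b by rewrite ler_peMl.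
have h4 : 0 <= x * (c * s) by rewrite mulr_ge0.
(* One step gives at most [(1 + x) * (r K + c * s) + b]: the first part is bounded through
   [1 + x <= expR x], and [b] is enlarged by [E * expR x >= 1]. *)
have := step K; rewrite -/x -/b; nra.
Qed.

Lemma recursion_bound : exists C1 C2 : R, [/\ 0 < C1, 0 < C2 &
  forall K : nat, \sum_(k < K) alpha k * G k <=
    C1 + C2 * \sum_(k < K) alpha k * eps k ^+ 2].
Proof.
have S0 : 0 <= S by have := sum_alpha 0; rewrite big_ord0.
have E0 := expR_gt0 (a * S).
(* Both constants come from dividing the Gronwall bound by [c]; the added 1 makes each strictly
   positive. *)
exists (c^-1 * (expR (a * S) * (r 0%N + q * S)) + 1),
       (c^-1 * (expR (a * S) * D) + 1); split.
- by rewrite ltr_wpDl// !mulr_ge0 ?invr_ge0 ?addr_ge0 ?mulr_ge0// ltW.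
- by rewrite ltr_wpDl// !mulr_ge0 ?invr_ge0// ltW.
move=> K; set se := \sum_(k < K) alpha k * eps k ^+ 2.
have se0 : 0 <= se.
  by rewrite sumr_ge0// => k _; rewrite mulr_ge0 ?sqr_ge0// ltW.
have h1 : c * \sum_(k < K) alpha k * G k <=
    expR (a * S) * (r 0%N + q * S + D * se).
  apply: le_trans (le_trans _ (recursion_gronwall K)) _; first by rewrite lerDr.
  rewrite big_split/= -!mulr_sumr -/se; apply: ler_pM.
  - exact: expR_ge0.
  - rewrite !addr_ge0 ?mulr_ge0// sumr_ge0// => k _; exact: sqr_ge0.
  - by rewrite ler_expR; exact: ler_wpM2l (sum_alpha K).
  - by rewrite addrA lerD2r lerD2l; exact: ler_wpM2l (sum_alpha K).
have h2 : \sum_(k < K) alpha k * G k <=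
    c^-1 * (expR (a * S) * (r 0%N + q * S + D * se)).
  by rewrite -[leLHS](mulKf (lt0r_neq0 c0)) ler_wpM2l// invr_ge0 ltW.
apply: le_trans h2 _; rewrite -subr_ge0.
rewrite (_ : _ - _ = 1 + se); [by rewrite addr_ge0|ring].
Qed.

End Recursion.

(** Otherwise every term exceeds [M / (K * alpha K)], and since each weight [alpha k] is at least
    [alpha K], the weighted sum exceeds [M]. *)
Lemma exists_small_term (R : realType) (G alpha : nat -> R) (K : nat) (M : R) :
  (0 < K)%N -> (forall k, 0 < alpha k) -> (forall k, alpha k.+1 <= alpha k) ->
  (forall k, 0 <= G k) -> \sum_(k < K) alpha k * G k <= M ->
  exists k : 'I_K, G k <= M / (K%:R * alpha K).
Proof.
move=> K0 a0 an G0 sM.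
have Ka : 0 < K%:R * alpha K by rewrite mulr_gt0// ltr0n.
have amono k : (k <= K)%N -> alpha K <= alpha k.
  by move/nonincreasing_seqP: an; exact.
apply/not_existsP => h.
have {}h (k : 'I_K) : M / (K%:R * alpha K) < G k.
  by rewrite ltNge; apply/negP; exact: h.
suff : M < \sum_(k < K) alpha k * G k by rewrite ltNge sM.
have {1}-> : M = \sum_(k < K) alpha K * (M / (K%:R * alpha K)).
  rewrite sumr_const card_ord -mulr_natl; field.
  by rewrite gt_eqF//= pnatr_eq0 -lt0n.
apply: (@lt_le_trans _ _ (\sum_(k < K) alpha K * G k)).
  apply: ltr_sum; last by move=> k _; rewrite ltr_pM2l.
  (* Strict comparison of sums requires a nonempty index set. *)
  by apply/hasP; exists (Ordinal K0) => //; rewrite mem_index_enum.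
by apply: ler_sum => k _; rewrite ler_wpM2r// amono// ltnW.
Qed.

(** * Choice of the constants and passage to the limit *)

Theorem mainTheorem3
  (R : realType) (d : measure_display) (Omega : measurableType d)
  (P : probability Omega R) (m n : nat)
  (f : 'I_m -> 'rV[R]_n -> R) (g : 'I_m -> 'rV[R]_n -> 'rV[R]_n)
  (Lgrad finf A B C : R)
  (v : nat -> 'I_m -> {RV P >-> R})
  (e : nat -> 'rV[R]_m -> 'rV[R]_n -> 'rV[R]_n)
  (theta0 : 'rV[R]_n) (alpha eps : nat -> R) (eta zeta rho : R)
  (* (A1) *)
  (Hgrad : forall i, is_gradient (f i) (g i))
  (Hlipi : forall i, exists Li : R, euclid_lipschitz (g i) Li)
  (Hbndi : forall i, exists c : R, forall x, c <= f i x)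
  (HL : euclid_lipschitz (gavg g) Lgrad)
  (Hfinf : forall x, finf <= favg f x)
  (HA : 0 <= A) (HB : 0 <= B) (HC : 0 <= C)
  (HABC : forall x,
     (\int[P]_w (sqnorm (gradv g (vrow v 0 w) x))%:E
      <= (2 * A * (favg f x - finf) + B * sqnorm (gavg g x) + C)%:E)%E)
  (* the distribution D and the sampling *)
  (Hindep : mutually_independent (fun p : nat * 'I_m => v p.1 p.2))
  (Hlaw : forall k i, same_law (v k i) (v 0 i))
  (Hmean : forall i, ('E_P[v 0%N i] = 1%:E)%E)
  (Hsq : forall i, P.-integrable setT (fun w => (v 0 i w ^+ 2)%:E))
  (He_meas : forall k, borel_map (fun p : 'rV[R]_m * 'rV[R]_n => e k p.1 p.2))
  (* (A2) *)
  (Heps : forall k, 0 <= eps k)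
  (HA2 : forall k (S : set 'rV[R]_n), borel_set S ->
     (\int[P]_(w in isgd g e v alpha theta0 k @^-1` S)
        (sqnorm (e k (vrow v k w) (isgd g e v alpha theta0 k w)))%:E
      <= (eps k ^+ 2)%:E * P (isgd g e v alpha theta0 k @^-1` S))%E)
  (* (A3) *)
  (Hpos : forall k, 0 < alpha k)
  (Hnoninc : forall k, alpha k.+1 <= alpha k)
  (Hsum : cvg (series (fun k => alpha k ^+ 2) @ \oo))
  (Hka : (fun k : nat => (k%:R * alpha k)^-1) @ \oo --> 0)
  (* parameters *)
  (Heta : 0 < eta) (Hzeta : 2^-1 < zeta) (Hrho0 : 0 < rho) (Hrho1 : rho < 1)
  (Halpha0 : alpha 0 * (zeta * Lgrad * ((1 + eta) / eta * B))
             <= rho * (2 * zeta - 1)) :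
  (exists C1 C2 : R, 0 < C1 /\ 0 < C2 /\
    forall K : nat, (1 <= K)%N ->
      (\big[mine/+oo]_(k < K)
          \int[P]_w (sqnorm (gavg g (isgd g e v alpha theta0 k w)))%:E
       <= (C1 / (K%:R * alpha K) + C2 * LK alpha eps K)%:E)%E)
  /\
  (LK alpha eps @ \oo --> 0 ->
    (fun K : nat => \big[mine/+oo]_(k < K)
          \int[P]_w (enorm (gavg g (isgd g e v alpha theta0 k w)))%:E)%E
    @ \oo --> 0%E).
Proof.
have zeta0 : 0 < zeta by apply: lt_trans Hzeta; rewrite invr_gt0.
(* In dimension 0 a Lipschitz constant may be negative. *)
pose L := Num.max Lgrad 0.
have L0 : 0 <= L by rewrite le_max lexx orbT.
have HL' : euclid_lipschitz (gavg g) L.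
  move=> x y; apply: le_trans (HL x y) _.
  by apply: ler_wpM2r; [exact: enorm_ge0|rewrite le_max lexx].
(* Testing (A2) on the whole space turns the conditional bound into one on the total second
   moment. *)
have HA2' k : (\int[P]_w (sqnorm (e k (vrow v k w)
    (isgd g e v alpha theta0 k w)))%:E <= (eps k ^+ 2)%:E)%E.
  have bT : borel_set (setT : set 'rV[R]_n).
    by apply: sub_sigma_algebra; exact: openT.
  by have := HA2 k setT bT; rewrite preimage_setT probability_setT mule1.
have ED := expected_descent Hindep Hlaw Hmean Hsq Hlipi He_meas HA2'
  Hgrad HL' L0 Hfinf HABC Hpos Heta zeta0.
have isq k := square_integrable_sqnorm (gavg_square_integrable Hindep Hlaw Hmean
  Hsq Hlipi He_meas HA2' HL' k).
set r := gap v g e theta0 alpha f finf in ED.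
set G := meangrad v g e theta0 alpha in ED.
have r0 k : 0 <= r k by apply: Rintegral_ge0 => w _; rewrite subr_ge0.
have G0 k : 0 <= G k by apply: Rintegral_ge0 => w _; exact: sqnorm_ge0.
have alpha_le k : alpha k <= alpha 0%N.
  by move/nonincreasing_seqP : Hnoninc; exact.
pose e1 := 1 + eta^-1.
have e1E : (1 + eta) / eta = e1.
  by rewrite /e1 mulrDl mul1r divff ?gt_eqF// addrC.
have e10 : 0 < e1 by rewrite addr_gt0// invr_gt0.
(* If [L] is 0, the left side vanishes and the right side is nonnegative because [zeta > 1/2]. *)
have zE : alpha 0%N * (zeta * L * (e1 * B)) <= rho * (2 * zeta - 1).
  rewrite /L; case: (leP Lgrad 0) => _; last by rewrite -e1E.
  rewrite mulr0 mul0r mulr0 mulr_ge0 ?(ltW Hrho0)//; lra.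
(* Young's inequality leaves the factor [1 - (2 * zeta)^-1] on the gradient term, and the step size
   condition lets the [B] term consume at most a fraction [rho] of it. *)
pose c := (1 - rho) * (1 - (2 * zeta)^-1).
have hz : (2 * zeta)^-1 < 1 by rewrite invf_lt1; lra.
have c0 : 0 < c by rewrite mulr_gt0// subr_gt0.
have Lab k : L / 2 * alpha k * e1 * B <= rho * (1 - (2 * zeta)^-1).
  have h1 : L / 2 * alpha k * e1 * B <= L / 2 * alpha 0%N * e1 * B.
    apply: ler_wpM2r => //; apply: ler_wpM2r; first exact: ltW.
    by apply: ler_wpM2l => //; exact: divr_ge0.
  apply: le_trans h1 _.
  have -> : L / 2 * alpha 0%N * e1 * B =
      (2 * zeta)^-1 * (alpha 0%N * (zeta * L * (e1 * B))).
    by field; rewrite gt_eqF.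
  have -> : rho * (1 - (2 * zeta)^-1) = (2 * zeta)^-1 * (rho * (2 * zeta - 1)).
    by field; rewrite gt_eqF.
  by apply: ler_wpM2l => //; rewrite invr_ge0 mulr_ge0// ltW.
(* The coefficients [a], [q] and [D] collect the [A], [C] and error contributions; in [D] one factor
   [alpha k] is bounded by [alpha 0], so the error enters linearly in the step size. *)
pose a := L * e1 * A; pose q := L / 2 * e1 * C.
pose D := zeta / 2 + L / 2 * alpha 0%N * (1 + eta).
have a0 : 0 <= a by rewrite !mulr_ge0// ltW.
have q0 : 0 <= q by rewrite !mulr_ge0// ltW.
have D0 : 0 <= D.
  rewrite addr_ge0//; first by rewrite divr_ge0// ltW.
  by rewrite !mulr_ge0// ltW// addr_gt0.
have step k : r k.+1 <= (1 + a * alpha k ^+ 2) * r k -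
    c * (alpha k * G k) + (q * alpha k ^+ 2 + D * (alpha k * eps k ^+ 2)).
  apply: le_trans (ED k) _; rewrite -/e1.
  have h1 : L / 2 * alpha k * e1 * B * (alpha k * G k) <=
      rho * (1 - (2 * zeta)^-1) * (alpha k * G k).
    by apply: ler_wpM2r => //; rewrite mulr_ge0// ltW.
  have h2 : L / 2 * (1 + eta) * (alpha k * eps k ^+ 2) * alpha k <=
      L / 2 * (1 + eta) * (alpha k * eps k ^+ 2) * alpha 0%N.
    by apply: ler_wpM2l => //; rewrite !mulr_ge0 ?sqr_ge0// ltW// addr_gt0.
  move: h1 h2; rewrite /c /a /q /D.
  move: ((2 * zeta)^-1) (alpha k) (alpha 0%N) (eps k) (r k) (G k) => z' al al0 ep rk Gk.
  lra.
have [S sumS] : exists S, forall K : nat, \sum_(k < K) alpha k ^+ 2 <= S.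
  exists (limn (series (fun k => alpha k ^+ 2))) => K.
  rewrite -(big_mkord xpredT (fun k => alpha k ^+ 2)).
  apply: nondecreasing_cvgn_le Hsum K.
  by apply: nondecreasing_series => k _ _; exact: sqr_ge0.
have [C1 [C2 [C10 C20 bound]]] := recursion_bound a0 c0 q0 D0 r0 G0 Hpos sumS step.
pose bd K := C1 / (K%:R * alpha K) + C2 * LK alpha eps K.
have good K : (1 <= K)%N -> exists k : 'I_K, G k <= bd K.
  move=> K1; have [k Gk] := exists_small_term K1 Hpos Hnoninc G0 (bound K).
  by exists k; apply: le_trans Gk _; rewrite /bd /LK mulrDl -!mulrA [_^-1 * _]mulrC.
split.
  exists C1, C2; split => //; split => // K K1; have [k Gk] := good K K1.
  apply: le_trans (bigmin_le _ k _) _.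
  by rewrite rintegrableE ?lee_fin//; exact: isq.
move=> LK0.
have bd_gt0 K : (1 <= K)%N -> 0 < bd K.
  move=> K1; rewrite ltr_pwDl//.
    by rewrite divr_gt0// mulr_gt0// ltr0n.
  rewrite mulr_ge0 ?(ltW C20)// mulr_ge0//.
    by rewrite invr_ge0 mulr_ge0// ltW.
  by apply: sumr_ge0 => k _; rewrite mulr_ge0 ?sqr_ge0// ltW.
have bd0 : bd @ \oo --> 0.
  have : bd @ \oo --> C1 * 0 + C2 * 0.
    by apply: cvgD; [apply: cvgMr Hka|apply: cvgMr LK0].
  by rewrite !mulr0 addr0.
have small K : (1 <= K)%N -> (0 <= \big[mine/+oo]_(k < K)
      \int[P]_w (enorm (gavg g (isgd g e v alpha theta0 k w)))%:E
    <= (Num.sqrt (bd K))%:E)%E.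
  move=> K1; apply/andP; split.
    by apply: le_bigmin => // k _; apply: integral_ge0 => w _;
      rewrite lee_fin; exact: enorm_ge0.
  have [k Gk] := good K K1; apply: le_trans (bigmin_le _ k _) _.
  (* In place of Jensen's inequality: [x <= x ^+ 2 / (2 * t) + t / 2] pointwise, and integrating
     with [G k <= t ^+ 2] gives [t / 2 + t / 2 = t]. Strict positivity of [bd K] permits the
     division. *)
  set t := Num.sqrt (bd K).
  have t0 : 0 < t by rewrite sqrtr_gt0 bd_gt0.
  have t2 : t ^+ 2 = bd K by rewrite sqr_sqrtr// ltW// bd_gt0.
  have iY : rintegrable P (fun w => (2 * t)^-1 *
      sqnorm (gavg g (isgd g e v alpha theta0 k w)) + t / 2).
    by apply: rintegrableD; [apply: rintegrableZ; exact: isq|exact: rintegrable_cst].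
  have pw w : enorm (gavg g (isgd g e v alpha theta0 k w)) <= (2 * t)^-1 *
      sqnorm (gavg g (isgd g e v alpha theta0 k w)) + t / 2.
    rewrite -sqr_enorm; set x := enorm _.
    rewrite -subr_ge0 (_ : _ - _ = (2 * t)^-1 * (x - t) ^+ 2).
      by rewrite mulr_ge0 ?sqr_ge0// invr_ge0 mulr_ge0// ltW.
    by field; rewrite gt_eqF.
  have iE : rintegrable P (fun w => enorm (gavg g (isgd g e v alpha theta0 k w))).
    apply: rintegrable_le iY _ => [|w]; last by rewrite ger0_norm// enorm_ge0.
    have ms : measurable_fun setT (@Num.sqrt R).
      by apply: continuous_measurable_fun; exact: sqrt_continuous.
    exact: (measurableT_comp ms (rintegrable_measurable (isq k))).
  rewrite rintegrableE// lee_fin.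
  apply: le_trans (le_Rintegral measurableT iE iY (fun w _ => pw w)) _.
  rewrite RintegralD//; [|exact: rintegrableZ (isq k)|exact: rintegrable_cst].
  rewrite RintegralZl//; last exact: isq.
  rewrite Rintegral_prob_cst -/(G k).
  have : (2 * t)^-1 * G k <= (2 * t)^-1 * t ^+ 2.
    by apply: ler_wpM2l; rewrite ?t2// invr_ge0 mulr_ge0// ltW.
  have -> : (2 * t)^-1 * t ^+ 2 = t / 2 by field; rewrite gt_eqF.
  by move=> h; rewrite [leRHS]splitr lerD2r.
have sq0 : (Num.sqrt (bd K))%:E @[K --> \oo] --> 0%E.
  apply: cvg_EFin; first exact: nearW.
  by rewrite -[0]sqrtr0; apply: continuous_cvg bd0; exact: sqrt_continuous.
(* The bounds are claimed only from [K = 1] on, since the empty minimum at [K = 0] is [+oo]. *)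
have squeeze : \forall K \near \oo, (0 <= \big[mine/+oo]_(k < K)
      \int[P]_w (enorm (gavg g (isgd g e v alpha theta0 k w)))%:E
    <= (Num.sqrt (bd K))%:E)%E.
  by exists 1%N => // K /= K1; exact: small.
by apply: (squeeze_cvge squeeze _ sq0); exact: cvg_cst.
Qed.
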